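(* Let $(\mathfrak{X},+,\mathcal{A})$ be a measurable Abelian group, $k\in\mathbb{N}$, $n\in\mathbb{Z}_+=\{0,1,2,\dots\}$, let $G$ be a probability distribution and $U$ a finite signed measure on $(\mathfrak{X},\mathcal{A})$. Assume that $|U|$ is absolutely continuous with respect to $G$ and that $U(\mathfrak{X})=0$. Let $f^{\pm}$ denote any Radon–Nikodym densities of $U^{\pm}$ with respect to $G$ and put $f=f^+-f^-$. Then \[\|U^k\,G^n\|\leq\binom{n+k}{k}^{-1/2}\Big(\int f^2\,dG\Big)^{k/2}.\]
   Context: A measurable Abelian group $(\mathfrak{X},+,\mathcal{A})$ is a commutative group $(\mathfrak{X},+)$ together with a $\sigma$-algebra $\mathcal{A}$ on $\mathfrak{X}$ such that $(x,y)\mapsto x-y$ is measurable from $(\mathfrak{X}\times\mathfrak{X},\mathcal{A}\otimes\mathcal{A})$ to $(\mathfrak{X},\mathcal{A})$. Products and powers of finite signed measures are convolutions: $VW(A)=\int_{\mathfrak{X}}V(A-x)\,dW(x)$, with zeroth power equal to the Dirac measure $I$ at the identity $0$. $U=U^+-U^-$ is the Hahn–Jordan decomposition, $|U|=U^++U^-$ the total variation measure, $\|U\|=|U|(\mathfrak{X})$ the total variation norm. The integral $\int f^2\,dG$ may be $+\infty$, in which case the right-hand side is $+\infty$. *)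

(* Defs.v *)
From HB Require Import structures.
From mathcomp Require Import all_boot all_order all_algebra.
From mathcomp Require Import all_classical all_reals.
From mathcomp Require Import measurable_structure measurable_function.

Set Implicit Arguments.
Unset Strict Implicit.
Unset Printing Implicit Defensive.

HB.mixin Record hasMeasurableSub (d : measure_display) X
    & Measurable d X & GRing.Zmodule X := {
  measurable_sub : measurable_fun [set: X * X] (fun z : X * X => (z.1 - z.2)%R)
}.

#[short(type="measurableAbelianGroupType")]
HB.structure Definition MeasurableAbelianGroup (d : measure_display) :=
  {X of Measurable d X & GRing.Zmodule X & hasMeasurableSub d X}.

(* The library's structures on normed types already join [Pointed] with the
   algebraic hierarchy, so [MeasurableAbelianGroup] has to precede them. *)
From mathcomp Require Import all_analysis measurable_realfun.

Import Order.TTheory GRing.Theory Num.Theory.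
Import numFieldNormedType.Exports.

Local Open Scope classical_set_scope.
Local Open Scope ring_scope.
Local Open Scope ereal_scope.

(* Finite signed measures are the library's charges. The library's Jordan
   decomposition depends on a proof that a given pair of sets is a Hahn
   decomposition; such a pair is chosen here (the resulting measures do not
   depend on it). *)
Section hahn_jordan.
Context (d : measure_display) (X : measurableType d) (R : realType).
Implicit Types V : {charge set X -> \bar R}.

Definition hahn_set_pos V : set X := projT1 (cid (Hahn_decomposition V)).

Definition hahn_set_neg V : set X :=
  projT1 (cid (projT2 (cid (Hahn_decomposition V)))).

Lemma hahn_setP V : hahn_decomposition V (hahn_set_pos V) (hahn_set_neg V).
Proof. exact: (projT2 (cid (projT2 (cid (Hahn_decomposition V))))). Qed.

Definition pos_part V : {finite_measure set X -> \bar R} :=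
  jordan_pos (hahn_setP V).

Definition neg_part V : {finite_measure set X -> \bar R} :=
  jordan_neg (hahn_setP V).

Definition charge_total_variation V : {measure set X -> \bar R} :=
  charge_variation (hahn_setP V).

Definition tv_norm V : \bar R := charge_total_variation V [set: X].

Lemma charge_total_variationE V A :
  charge_total_variation V A = pos_part V A + neg_part V A.
Proof. by []. Qed.

Lemma pos_part_sub_neg_part V A : measurable A ->
  V A = pos_part V A - neg_part V A.
Proof.
by move=> mA; rewrite (jordan_decomp (hahn_setP V) mA) /cadd/= cscaleN1.
Qed.

Definition charge_integral V (g : X -> \bar R) : \bar R :=
  \int[pos_part V]_x g x - \int[neg_part V]_x g x.

(* [f] need not be nonnegative everywhere: integrability together with
   [0 <= mu] makes it nonnegative [G]-almost everywhere. *)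
Definition is_RN_density (G : {measure set X -> \bar R})
    (mu : {measure set X -> \bar R}) (f : X -> R) :=
  G.-integrable [set: X] (EFin \o f) /\
  forall A, measurable A -> mu A = \int[G]_(x in A) (f x)%:E.

End hahn_jordan.

Section convolution.
Context (d : measure_display) (X : measurableAbelianGroupType d) (R : realType).
Implicit Types (V W : {charge set X -> \bar R}) (A : set X) (x : X).

Definition translate A x : set X := [set (a - x)%R | a in A].

Lemma translateE A x : translate A x = [set y | A (y + x)%R].
Proof.
apply/seteqP; split=> [_ [a Aa <-]|y Ay] /=; first by rewrite subrK.
by exists (y + x)%R => //; rewrite addrK.
Qed.

Lemma measurable_add :
  measurable_fun [set: X * X] (fun z : X * X => (z.1 + z.2)%R).
Proof.
rewrite (_ : (fun _ => _) =
  (fun z : X * X => (z.1 - z.2)%R) \o (fun z : X * X => (z.1, (0 - z.2)%R))).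
  apply: measurableT_comp; first exact: measurable_sub.
  apply/measurable_fun_pairP; split => /=; first exact: measurable_fst.
  apply: (measurableT_comp (f := fun z : X * X => (z.1 - z.2)%R)
    (g := fun z : X * X => (0%R, z.2))); first exact: measurable_sub.
  apply/measurable_fun_pairP; split => /=; first exact: measurable_cst.
  exact: measurable_snd.
by apply/funext => -[y x] /=; rewrite sub0r opprK.
Qed.

Lemma translate_ysection A x :
  translate A x = ysection [set z : X * X | A (z.1 + z.2)%R] x.
Proof.
by rewrite translateE ysectionE.
Qed.

Lemma measurable_add_preimage A : measurable A ->
  measurable [set z : X * X | A (z.1 + z.2)%R].
Proof.
by move=> mA; rewrite -[X in measurable X]setTI; exact: measurable_add.
Qed.

Lemma measurable_translate A x : measurable A -> measurable (translate A x).
Proof.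
move=> mA; rewrite translate_ysection.
by apply: measurable_ysection; exact: measurable_add_preimage.
Qed.

Lemma measurable_fun_translate V A : measurable A ->
  measurable_fun [set: X] (fun x => V (translate A x)).
Proof.
move=> mA; rewrite (_ : (fun _ => _) = (fun x =>
    (pos_part V \o ysection [set z : X * X | A (z.1 + z.2)%R]) x -
    (neg_part V \o ysection [set z : X * X | A (z.1 + z.2)%R]) x)).
  by apply: emeasurable_funB; apply: measurable_fun_ysection;
    exact: measurable_add_preimage.
apply/funext => x /=; rewrite -translate_ysection -pos_part_sub_neg_part//.
exact: measurable_translate.
Qed.

Lemma abse_le_tv_norm V A : measurable A -> `|V A| <= tv_norm V.
Proof.
move=> mA; apply: (@le_trans _ _ (charge_total_variation V A)).
  exact: abse_charge_variation.
by apply: le_measure; rewrite ?inE.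
Qed.

Lemma tv_norm_fin_num V : tv_norm V \is a fin_num.
Proof. by rewrite /tv_norm charge_total_variationE fin_numD !fin_num_measure. Qed.

Lemma integrable_translate V (mu : {finite_measure set X -> \bar R}) A :
  measurable A -> mu.-integrable [set: X] (fun x => V (translate A x)).
Proof.
move=> mA; apply: (@le_integrable _ _ _ _ _ _ _ (cst (tv_norm V))) => //.
- exact: measurable_fun_translate.
- move=> x _ /=; rewrite (gee0_abs (measure_ge0 _ _)).
  exact/abse_le_tv_norm/measurable_translate.
- rewrite -(fineK (tv_norm_fin_num V)).
  exact: finite_measure_integrable_cst.
Qed.

Definition convolution V W : set X -> \bar R :=
  fun A => charge_integral W (fun x => V (translate A x)).

Section convolution_charge.
Variables V W : {charge set X -> \bar R}.

Let convolution0 : convolution V W set0 = 0.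
Proof.
rewrite /convolution /charge_integral.
under eq_integral do rewrite /translate image_set0 charge0.
rewrite integral0.
under eq_integral do rewrite /translate image_set0 charge0.
by rewrite integral0 sube0.
Qed.

Let convolution_fin A : measurable A -> convolution V W A \is a fin_num.
Proof.
move=> mA; rewrite fin_numB; apply/andP.
by split; apply: integrable_fin_num => //; exact: integrable_translate.
Qed.

Let cvg_integral (mu : {finite_measure set X -> \bar R}) (F : (set X)^nat) :
  (forall i, measurable (F i)) -> trivIset [set: nat] F ->
  \sum_(0 <= i < n) \int[mu]_x V (translate (F i) x) @[n --> \oo] -->
  \int[mu]_x V (translate (\bigcup_i F i) x).
Proof.
move=> mF tF.
have mtF i x : measurable (translate (F i) x) by exact: measurable_translate.
have ttF x : trivIset [set: nat] (fun i => translate (F i) x).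
  apply/trivIsetP => i j _ _ ij; rewrite !translateE.
  move/trivIsetP : tF => /(_ i j Logic.I Logic.I ij) FF.
  apply/seteqP; split => // y /= Fy.
  by have : (F i `&` F j) (y + x)%R by []; rewrite FF.
have UtF x : translate (\bigcup_i F i) x = \bigcup_i translate (F i) x.
  by rewrite translateE; apply/seteqP; split => y [i _ Fi];
    exists i => //; move: Fi; rewrite translateE.
have SE n x : \sum_(0 <= i < n) V (translate (F i) x) =
    V (\big[setU/set0]_(i < n) translate (F i) x).
  rewrite big_mkord (@charge_semi_additive _ _ _ V (fun i => translate (F i) x))//.
  exact: bigsetU_measurable.
rewrite (_ : (fun n => _) = (fun n =>
    \int[mu]_x \sum_(0 <= i < n) V (translate (F i) x))); last first.
  apply/funext => n; rewrite integral_sum// => i.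
  exact: integrable_translate.
apply: (@dominated_cvg _ _ _ mu _ measurableT
  (fun n x => \sum_(0 <= i < n) V (translate (F i) x)) _ (cst (tv_norm V))).
- move=> n; apply: emeasurable_sum => i.
  exact: measurable_fun_translate.
- move=> x _; rewrite UtF; apply: charge_semi_sigma_additive => //.
  exact: bigcupT_measurable.
- by move=> x _; exact: tv_norm_fin_num.
- rewrite -(fineK (tv_norm_fin_num V)).
  exact: finite_measure_integrable_cst.
- move=> n x _; rewrite SE; apply: abse_le_tv_norm.
  exact: bigsetU_measurable.
Qed.

Let convolution_sigma_additive : semi_sigma_additive (convolution V W).
Proof.
move=> F mF tF mUF; rewrite /convolution /charge_integral.
under eq_fun.
  move=> n; rewrite big_split/= sumeN; last first.
    move=> i j _ _; rewrite fin_num_adde_defl//.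
    by apply: integrable_fin_num => //; exact: integrable_translate.
  over.
apply: cvgeB; [|exact: cvg_integral|exact: cvg_integral].
rewrite fin_num_adde_defr//; apply: integrable_fin_num => //.
exact: integrable_translate.
Qed.

HB.instance Definition _ := isCharge.Build _ _ _ (convolution V W)
  convolution0 convolution_fin convolution_sigma_additive.

End convolution_charge.

Definition dirac_zero : {finite_measure set X -> \bar R} := \d_(0%R : X).

Fixpoint convolution_power V (n : nat) : {charge set X -> \bar R} :=
  if n is m.+1 then convolution (convolution_power V m) V
  else charge_of_finite_measure dirac_zero.

End convolution.

(* Main.v *)
Require Import Defs.
From HB Require Import structures.
From mathcomp Require Import all_boot all_order all_algebra.
From mathcomp Require Import all_classical all_reals all_analysis measurable_realfun.
From mathcomp Require Import ring lra.

(** Let f be the density of U with respect to G, so that the integral of f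
    with respect to G is 0, and let F be the integral of f^2. For independent
    variables X_1, X_2, ... with law G and S = X_1 + ... + X_(n+k), the value
    of U^k G^n at A is the expectation of 1_A(S) f(X_i1) ... f(X_ik) for every
    choice of k distinct indices among the n + k. Averaging over these choices
    replaces the product by e_k / C(n+k,k), with e_k the elementary symmetric
    polynomial in the f(X_i); its terms are orthogonal because f has mean 0,
    so E(e_k^2) = C(n+k,k) F^k, and the Cauchy-Schwarz inequality gives the
    bound.

    The proof below is the dual form of this argument and needs integrals over
    two copies of the group only. With E phi (y) and D phi (y) the integrals of
    phi(x + y) and of f(x) phi(x + y) with respect to G(dx), acting on bounded
    measurable phi, the value of U^k G^n at A is (E^n D^k 1_A)(0)
    ([convolution_powersE]). Fix N = n + k and put L_k = C(N,k) E^(N-k) D^k,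
    so that (L_k phi)(0) is the expectation of phi(S) e_k. The recursion
    e_k(x_1,...,x_(N+1)) = e_k(x_1,...,x_N) + f(x_(N+1)) e_(k-1)(x_1,...,x_N)
    is Pascal's rule for the L_k, since D and E commute ([conv_opC]).
    Orthogonality of 1 and f gives Bessel's inequality
    (D phi)^2 <= F (E phi^2 - (E phi)^2) pointwise ([bessel_conv_op]). The two
    combine into (L_k phi)^2 <= C(N,k) F^k E^N phi^2
    ([sqr_iter_conv_op_le]). The theorem is the case where phi is 1 on the
    positive Hahn set and -1 on the negative one: then phi^2 <= 1, so
    E^N phi^2 <= 1, and (E^n D^k phi)(0) is the total variation norm. *)

Set Implicit Arguments.
Unset Strict Implicit.
Unset Printing Implicit Defensive.

Import Order.TTheory GRing.Theory Num.Theory.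
Import numFieldNormedType.Exports.

Local Open Scope classical_set_scope.
Local Open Scope ring_scope.

(** * Two elementary inequalities *)

(** The Cauchy-Schwarz inequality for the vectors (sqrt c, sqrt e) and
    (sqrt a, sqrt b), without square roots. *)
Lemma sqrD_le (R : realDomainType) (p q c e a b : R) :
  0 <= c -> 0 <= e -> 0 <= a -> 0 <= b ->
  p ^+ 2 <= c * a -> q ^+ 2 <= e * b -> (p + q) ^+ 2 <= (c + e) * (a + b).
Proof.
move=> c0 e0 a0 b0 pca qeb.
have le_cross : 2 * (p * q) <= c * b + e * a.
  rewrite (le_trans (ler_norm _))// -ler_sqr ?nnegrE ?addr_ge0 ?mulr_ge0//.
  rewrite real_normK ?num_real// !exprMn.
  have : p ^+ 2 * q ^+ 2 <= (c * a) * (e * b) by rewrite ler_pM ?sqr_ge0.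
  have := sqr_ge0 (c * b - e * a).
  by move=> ? ?; nra.
by nra.
Qed.

Lemma le_powR_sqr (R : realType) (c F t : R) (k : nat) :
  0 < c -> 0 <= F -> 0 <= t -> (c * t) ^+ 2 <= c * F ^+ k ->
  t <= c `^ (- 2^-1) * F `^ (k%:R / 2).
Proof.
move=> c0 F0 t0 ctF.
rewrite -ler_sqr ?nnegrE ?mulr_ge0 ?powR_ge0// exprMn -!powR_mulrn ?powR_ge0//.
rewrite -!powRrM mulNr mulVf ?pnatr_eq0// divfK ?pnatr_eq0//.
rewrite powR_inv1 ?(ltW c0)//.
rewrite !powR_mulrn// ler_pdivlMl// -(ler_pM2l c0); apply: le_trans ctF.
by rewrite exprMn mulrA.
Qed.

(** * Bounded measurable functions *)

Section bounded_measurable.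
Context d (T : measurableType d) (R : realType).
Implicit Types (f g : T -> R) (mu : {finite_measure set T -> \bar R}).

Definition bounded_measurable f :=
  measurable_fun [set: T] f /\ exists M, forall x, `|f x| <= M.

Lemma bounded_measurable_bounded f :
  bounded_measurable f -> [bounded f x | x in [set: T]].
Proof.
move=> [_ [M fM]]; exists M; split; first exact: num_real.
by move=> N MN x _; apply: le_trans (fM x) (ltW MN).
Qed.

Lemma bounded_measurable_cst (r : R) : bounded_measurable (cst r).
Proof. by split => //; exists `|r|. Qed.

Lemma bounded_measurable_indic A : measurable A ->
  bounded_measurable (\1_A : T -> R).
Proof.
move=> mA; split; first exact: measurable_indic.
by exists 1 => x; rewrite indicE; case: (_ \in _); rewrite ?normr1 ?normr0.
Qed.

Lemma bounded_measurableB f g :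
  bounded_measurable f -> bounded_measurable g ->
  bounded_measurable (fun x => f x - g x).
Proof.
move=> [mf [M fM]] [mg [N gN]]; split; first exact: measurable_funB.
by exists (M + N) => x; rewrite (le_trans (ler_normB _ _))// lerD.
Qed.

Lemma bounded_measurableM f g :
  bounded_measurable f -> bounded_measurable g ->
  bounded_measurable (fun x => f x * g x).
Proof.
move=> [mf [M fM]] [mg [N gN]]; split; first exact: measurable_funM.
by exists (M * N) => x; rewrite normrM ler_pM.
Qed.

Lemma bounded_measurable_sqr f :
  bounded_measurable f -> bounded_measurable (fun x => f x ^+ 2).
Proof. by move=> bf; exact: (bounded_measurableM bf bf). Qed.

Lemma integrable_mul_bounded (mu : {measure set T -> \bar R}) f g :
  mu.-integrable [set: T] (EFin \o f) -> bounded_measurable g ->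
  mu.-integrable [set: T] (EFin \o (fun x => f x * g x)).
Proof.
move=> intf bg; have mg := bg.1.
rewrite (_ : _ \o _ = (EFin \o f) \* (EFin \o g))%E; last first.
  by apply/funext => x /=; rewrite EFinM.
by apply: integrableMl => //; exact: bounded_measurable_bounded.
Qed.

Lemma integrableD_EFin (mu : {measure set T -> \bar R}) f g :
  mu.-integrable [set: T] (EFin \o f) -> mu.-integrable [set: T] (EFin \o g) ->
  mu.-integrable [set: T] (EFin \o (fun x => f x + g x)).
Proof.
move=> intf intg; under [_ \o _]eq_fun do rewrite /= EFinD.
exact: integrableD.
Qed.

Lemma integrable_scale (mu : {measure set T -> \bar R}) (c : R) f :
  mu.-integrable [set: T] (EFin \o f) ->
  mu.-integrable [set: T] (EFin \o (fun x => c * f x)).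
Proof.
move=> intf; under [_ \o _]eq_fun do rewrite /= mulrC.
exact: (integrable_mul_bounded intf (bounded_measurable_cst c)).
Qed.

Lemma integrable_cst_finite mu (r : R) :
  mu.-integrable [set: T] (EFin \o cst r).
Proof. exact: finite_measure_integrable_cst. Qed.

Lemma bounded_measurable_integrable mu g :
  bounded_measurable g -> mu.-integrable [set: T] (EFin \o g).
Proof.
move=> bg.
rewrite (_ : g = fun x => cst 1 x * g x); last first.
  by apply/funext => x; rewrite mul1r.
exact: (integrable_mul_bounded (integrable_cst_finite mu 1)).
Qed.

Lemma EFin_Rintegral (mu : {measure set T -> \bar R}) f :
  mu.-integrable [set: T] (EFin \o f) ->
  (\int[mu]_x f x)%:E = (\int[mu]_x (f x)%:E)%E.
Proof. by move=> intf; rewrite fineK//; exact: integrable_fin_num. Qed.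

End bounded_measurable.
Arguments bounded_measurable_cst {d T R}.

Section bounded_measurable_comp.
Context d d' (T : measurableType d) (T' : measurableType d') (R : realType).

Lemma bounded_measurable_comp (f : T' -> R) (g : T -> T') :
  bounded_measurable f -> measurable_fun [set: T] g ->
  bounded_measurable (fun x => f (g x)).
Proof.
move=> [mf [M fM]] mg; split; first exact: measurableT_comp.
by exists M.
Qed.

Lemma integrable_tensor (m1 : {finite_measure set T -> \bar R})
    (m2 : {finite_measure set T' -> \bar R}) (f : T -> R) (g : T' -> R) :
  m1.-integrable [set: T] (EFin \o f) -> m2.-integrable [set: T'] (EFin \o g) ->
  (m1 \x m2)%E.-integrable [set: T * T'] (EFin \o (fun z => f z.1 * g z.2)).
Proof.
move=> intf intg.
have mf : measurable_fun setT f by apply/measurable_EFinP/measurable_int/intf.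
have mg : measurable_fun setT g by apply/measurable_EFinP/measurable_int/intg.
apply/integrable12ltyP => /=.
  apply/measurable_EFinP; apply: measurable_funM.
    exact: (measurableT_comp mf measurable_fst).
  exact: (measurableT_comp mg measurable_snd).
have /integrableP[_ fi] := intf; have /integrableP[_ gi] := intg.
rewrite (eq_integral (fun x => `|f x|%:E * \int[m2]_y `|(EFin \o g) y|))%E.
  rewrite ge0_integralZr//; last 2 first.
    exact/measurable_EFinP/measurableT_comp.
    exact: integral_ge0.
  apply: lte_mul_pinfty => //; first exact: integral_ge0.
  by rewrite ge0_fin_numE//; exact: integral_ge0.
move=> x _; under eq_integral do rewrite normrM EFinM.
rewrite ge0_integralZl//.
exact/measurable_EFinP/measurableT_comp.
Qed.

End bounded_measurable_comp.

(** * Convolution operators on bounded measurable functions *)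

Section conv_op.
Context d (X : measurableAbelianGroupType d) (R : realType).
Variable G : probability X R.
Implicit Types (f g phi psi : X -> R).

(** The adjoint of convolution with the charge of density f with respect to
    G: integrating [conv_op f phi] against W is integrating phi against
    W convolved with that charge. *)
Definition conv_op f phi (y : X) : R := \int[G]_x (f x * phi (x + y)).

Lemma measurable_shift (y : X) : measurable_fun [set: X] (fun x : X => x + y).
Proof.
apply: (measurableT_comp (f := fun z : X * X => z.1 + z.2)
    (g := fun x => (x, y))); first exact: measurable_add.
exact: measurable_pair2.
Qed.

Lemma bounded_measurable_shift phi y :
  bounded_measurable phi -> bounded_measurable (fun x => phi (x + y)).
Proof. by move=> bphi; apply: bounded_measurable_comp (measurable_shift y). Qed.

Lemma conv_op_integrable f phi y : G.-integrable [set: X] (EFin \o f) ->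
  bounded_measurable phi ->
  G.-integrable [set: X] (EFin \o (fun x => f x * phi (x + y))).
Proof.
by move=> intf bphi; apply: integrable_mul_bounded => //;
  exact: bounded_measurable_shift.
Qed.

Lemma bounded_measurable_conv_op f phi :
  G.-integrable [set: X] (EFin \o f) ->
  bounded_measurable phi -> bounded_measurable (conv_op f phi).
Proof.
move=> intf bphi; split.
  (* The factor [cst 1 z.2] puts the integrand in the form required by
     [integrable_tensor]; measurability in y comes from Fubini. *)
  have h : (G \x G)%E.-integrable [set: X * X]
      (EFin \o (fun z => f z.1 * cst 1 z.2 * phi (z.1 + z.2))).
    apply: integrable_mul_bounded.
      by apply: integrable_tensor => //; exact: integrable_cst_finite.
    exact: (bounded_measurable_comp (g := fun z : X * X => z.1 + z.2) bphi
      (@measurable_add _ X)).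
  rewrite (_ : conv_op f phi = fine \o fubini_G G
      (EFin \o (fun z : X * X => f z.1 * cst 1 z.2 * phi (z.1 + z.2)))).
    apply: measurableT_comp; first exact: fine_measurable.
    exact: (measurable_fubini_G (m1 := G) (m2 := G) h).
  apply/funext => y /=; congr fine.
  by apply: eq_integral => x _; rewrite /= mulr1.
have [_ [M phiM]] := bphi.
exists (\int[G]_x (`|f x| * M)) => y.
have M0 : 0 <= M by apply: le_trans (phiM 0); exact: normr_ge0.
have intnf : G.-integrable [set: X] (EFin \o (fun x => `|f x|)).
  exact: (integrable_norm intf).
apply: le_trans (le_normr_Rintegral _ _) _ => //.
  exact: conv_op_integrable.
apply: le_Rintegral => //.
- exact: (integrable_norm (conv_op_integrable _ intf bphi)).
- exact: integrable_mul_bounded intnf (bounded_measurable_cst M).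
- by move=> x _; rewrite normrM ler_wpM2l.
Qed.

(** Both sides are the double integral of f(x) g(z) phi(x + z + y); swapping
    the order of integration uses that the group is commutative. *)
Lemma conv_opC f g phi : G.-integrable [set: X] (EFin \o f) ->
  G.-integrable [set: X] (EFin \o g) -> bounded_measurable phi ->
  conv_op f (conv_op g phi) = conv_op g (conv_op f phi).
Proof.
move=> intf intg bphi; apply/funext => y; apply: EFin_inj.
have bf := bounded_measurable_conv_op intf bphi.
have bg := bounded_measurable_conv_op intg bphi.
have inth : (G \x G)%E.-integrable [set: X * X]
    (EFin \o (fun z => f z.1 * g z.2 * phi (z.1 + z.2 + y))).
  apply: integrable_mul_bounded; first exact: integrable_tensor.
  exact: (bounded_measurable_comp (g := fun z : X * X => z.1 + z.2)
    (bounded_measurable_shift y bphi) (@measurable_add _ X)).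
rewrite !EFin_Rintegral; try exact: conv_op_integrable.
transitivity (\int[G]_x \int[G]_z (f x * g z * phi (x + z + y))%:E)%E.
  apply: eq_integral => x _.
  rewrite -RintegralZl//; last exact: conv_op_integrable.
  rewrite EFin_Rintegral; last first.
    by apply: integrable_scale; exact: conv_op_integrable.
  by apply: eq_integral => z _; rewrite mulrA addrA (addrC z).
rewrite (Fubini inth) /=; apply: eq_integral => z _.
rewrite -RintegralZl//; last exact: conv_op_integrable.
rewrite EFin_Rintegral; last first.
  by apply: integrable_scale; exact: conv_op_integrable.
by apply: eq_integral => x _; rewrite addrA mulrCA mulrA.
Qed.

Lemma conv_opB f phi psi : G.-integrable [set: X] (EFin \o f) ->
  bounded_measurable phi -> bounded_measurable psi ->
  conv_op f (fun x => phi x - psi x) =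
  (fun y => conv_op f phi y - conv_op f psi y).
Proof.
move=> intf bphi bpsi; apply/funext => y.
rewrite /conv_op -RintegralB//; [|exact: conv_op_integrable..].
by apply: eq_Rintegral => x _; rewrite mulrBr.
Qed.

Lemma conv_opZ f phi (c : R) : G.-integrable [set: X] (EFin \o f) ->
  bounded_measurable phi ->
  conv_op f (fun x => c * phi x) = (fun y => c * conv_op f phi y).
Proof.
move=> intf bphi; apply/funext => y.
rewrite /conv_op -RintegralZl//; last exact: conv_op_integrable.
by apply: eq_Rintegral => x _; rewrite mulrCA.
Qed.

Section iterates.
Variable f : X -> R.
Hypothesis intf : G.-integrable [set: X] (EFin \o f).

Lemma bounded_measurable_iter n phi : bounded_measurable phi ->
  bounded_measurable (iter n (conv_op f) phi).
Proof.
by move=> bphi; elim: n => //= n IHn; exact: bounded_measurable_conv_op.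
Qed.

Lemma iter_conv_opB n phi psi :
  bounded_measurable phi -> bounded_measurable psi ->
  iter n (conv_op f) (fun x => phi x - psi x) =
  (fun y => iter n (conv_op f) phi y - iter n (conv_op f) psi y).
Proof.
move=> bphi bpsi; elim: n => //= n ->.
by rewrite conv_opB//; exact: bounded_measurable_iter.
Qed.

Lemma iter_conv_opZ n phi (c : R) : bounded_measurable phi ->
  iter n (conv_op f) (fun x => c * phi x) =
  (fun y => c * iter n (conv_op f) phi y).
Proof.
move=> bphi; elim: n => //= n ->.
by rewrite conv_opZ//; exact: bounded_measurable_iter.
Qed.

End iterates.

Definition mean_op : (X -> R) -> X -> R := conv_op (cst 1).

Let int1 : G.-integrable [set: X] (EFin \o cst 1).
Proof. exact: integrable_cst_finite. Qed.

Lemma mean_opE phi y : mean_op phi y = \int[G]_x phi (x + y).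
Proof. by apply: eq_Rintegral => x _; rewrite mul1r. Qed.

Lemma le_iter_mean_op n phi psi :
  bounded_measurable phi -> bounded_measurable psi ->
  (forall x, phi x <= psi x) ->
  forall y, iter n mean_op phi y <= iter n mean_op psi y.
Proof.
move=> bphi bpsi le_phipsi; elim: n => //= n IHn y.
apply: le_Rintegral => //; last by move=> x _; rewrite !mul1r.
  by apply: conv_op_integrable => //; exact: bounded_measurable_iter.
by apply: conv_op_integrable => //; exact: bounded_measurable_iter.
Qed.

Lemma mean_op_cst (c : R) : mean_op (cst c) = cst c.
Proof.
apply/funext => y; rewrite mean_opE /= Rintegral_cst//.
by rewrite [X in fine X]probability_setT mulr1.
Qed.

Lemma iter_mean_op_cst n (c : R) : iter n mean_op (cst c) = cst c.
Proof. by elim: n => //= n ->; rewrite mean_op_cst. Qed.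

Lemma iter_mean_op_ge0 n phi y : bounded_measurable phi ->
  (forall x, 0 <= phi x) -> 0 <= iter n mean_op phi y.
Proof.
move=> bphi phi0.
have := le_iter_mean_op n (bounded_measurable_cst 0) bphi phi0 y.
by rewrite iter_mean_op_cst.
Qed.

(** * The second-moment inequality *)

Section bessel.
Variable f : X -> R.
Hypothesis intf : G.-integrable [set: X] (EFin \o f).
Hypothesis intf2 : G.-integrable [set: X] (EFin \o (fun x => f x ^+ 2)).
Hypothesis f0 : \int[G]_x f x = 0.

Let F : R := \int[G]_x (f x ^+ 2).

(** The right-hand side is the integral of (psi - m - s f)^2, where psi is the
    translate of phi by y and m its mean: as 1 and f are orthogonal, no term
    in m s survives. *)
Lemma sqr_residual_ge0 phi y s : bounded_measurable phi ->
  0 <= mean_op (fun x => phi x ^+ 2) y - mean_op phi y ^+ 2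
       - 2 * s * conv_op f phi y + s ^+ 2 * F.
Proof.
move=> bphi; set psi := fun x => phi (x + y).
have bpsi : bounded_measurable psi by exact: bounded_measurable_shift.
set m := mean_op phi y; set b := conv_op f phi y.
set a := mean_op (fun x => phi x ^+ 2) y.
have -> : a - m ^+ 2 - 2 * s * b + s ^+ 2 * F =
    \int[G]_x ((psi x - m - s * f x) ^+ 2).
  have ipsi2 : G.-integrable [set: X] (EFin \o (fun x => psi x ^+ 2)).
    exact: bounded_measurable_integrable (bounded_measurableM bpsi bpsi).
  have ipsi : G.-integrable [set: X] (EFin \o psi).
    exact: bounded_measurable_integrable.
  have ifpsi := integrable_mul_bounded intf bpsi.
  have i1 := integrable_scale (- (2 * m)) ipsi.
  have i2 := integrable_cst_finite G (m ^+ 2).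
  have i3 := integrable_scale (- (2 * s)) ifpsi.
  have i4 := integrable_scale (2 * s * m) intf.
  have i5 := integrable_scale (s ^+ 2) intf2.
  have j4 := integrableD_EFin i4 i5.
  have j3 := integrableD_EFin i3 j4.
  have j2 := integrableD_EFin i2 j3.
  transitivity (\int[G]_x (psi x ^+ 2 + (- (2 * m) * psi x + (cst (m ^+ 2) x +
      (- (2 * s) * (f x * psi x) + (2 * s * m * f x + s ^+ 2 * f x ^+ 2)))))).
    rewrite !RintegralD//; do ?[exact: integrableD_EFin i4 i5
      |exact: integrableD_EFin i3 j4|exact: integrableD_EFin i2 j3
      |exact: integrableD_EFin i1 j2].
    rewrite Rintegral_cst// [X in fine X]probability_setT/= !RintegralZl// f0.
    have -> : \int[G]_x psi x = m by rewrite /m mean_opE.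
    have -> : \int[G]_x (psi x ^+ 2) = a by rewrite /a mean_opE.
    have -> : \int[G]_x (f x * psi x) = b by [].
    by rewrite -/F; ring.
  by apply: eq_Rintegral => x _; rewrite /=; ring.
by apply: Rintegral_ge0 => x _; exact: sqr_ge0.
Qed.

Lemma sqr_mean_op_le phi y : bounded_measurable phi ->
  mean_op phi y ^+ 2 <= mean_op (fun x => phi x ^+ 2) y.
Proof.
move=> bphi; have := sqr_residual_ge0 y 0 bphi.
by rewrite mulr0 !mul0r expr0n mul0r subr0 addr0 subr_ge0.
Qed.

(** Bessel's inequality for the translate of phi and the orthogonal pair 1, f:
    the quadratic in s of [sqr_residual_ge0] is nonnegative, hence its
    discriminant is nonpositive. *)
Lemma bessel_conv_op phi y : bounded_measurable phi ->
  conv_op f phi y ^+ 2 <=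
  F * (mean_op (fun x => phi x ^+ 2) y - mean_op phi y ^+ 2).
Proof.
move=> bphi; set m := mean_op phi y; set b := conv_op f phi y.
set a := mean_op (fun x => phi x ^+ 2) y.
have quad_ge0 s : 0 <= a - m ^+ 2 - 2 * s * b + s ^+ 2 * F.
  exact: sqr_residual_ge0.
have [F0|F_neq0] := eqVneq F 0.
  have [b0|b_neq0] := eqVneq b 0.
    by rewrite -/b b0 F0 expr0n mul0r.
  (* For F = 0 the quadratic is affine; this s makes its value -1. *)
  have := quad_ge0 ((a - m ^+ 2 + 1) / (2 * b)).
  rewrite F0 (_ : _ + _ = -1) ?ler0N1//.
  by field.
have F_gt0 : 0 < F.
  by rewrite lt_def F_neq0; apply: Rintegral_ge0 => x _; exact: sqr_ge0.
(* b / F is the minimizer of the quadratic. *)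
have := quad_ge0 (b / F).
rewrite (_ : _ + _ = (F * (a - m ^+ 2) - b ^+ 2) / F); last by field.
by rewrite pmulr_lge0 ?invr_gt0// subr_ge0.
Qed.

Let F_ge0 : 0 <= F.
Proof. by apply: Rintegral_ge0 => x _; exact: sqr_ge0. Qed.

Lemma le_iter_sqr_mean_op n phi y : bounded_measurable phi ->
  iter n mean_op (fun x => mean_op phi x ^+ 2) y <=
  iter n.+1 mean_op (fun x => phi x ^+ 2) y.
Proof.
move=> bphi; rewrite iterSr; apply: le_iter_mean_op => [||x].
- exact/bounded_measurable_sqr/bounded_measurable_conv_op.
- exact/bounded_measurable_conv_op/bounded_measurable_sqr.
- exact: sqr_mean_op_le.
Qed.

(** Bessel's inequality averaged over a sum of N independent variables: the
    averaging operator is linear and monotone. *)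
Lemma iter_mean_op_bessel N phi y : bounded_measurable phi ->
  iter N mean_op (fun x => conv_op f phi x ^+ 2) y <=
  F * (iter N.+1 mean_op (fun x => phi x ^+ 2) y -
       iter N mean_op (fun x => mean_op phi x ^+ 2) y).
Proof.
move=> bphi; have bphi2 := bounded_measurable_sqr bphi.
have bE2 := bounded_measurable_conv_op int1 bphi2.
have bsqE := bounded_measurable_sqr (bounded_measurable_conv_op int1 bphi).
have bD := bounded_measurable_conv_op intf bphi.
apply: le_trans (le_iter_mean_op N (bounded_measurable_sqr bD) _
  (fun x => bessel_conv_op x bphi) y) _.
  apply: (bounded_measurableM (bounded_measurable_cst F)).
  exact: bounded_measurableB.
rewrite [X in X <= _](_ : _ = F * iter N mean_op (fun x =>
  mean_op (fun z => phi z ^+ 2) x - mean_op phi x ^+ 2) y); last first.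
  by rewrite {1}/mean_op iter_conv_opZ//; exact: bounded_measurableB.
by rewrite iterSr {1}/mean_op iter_conv_opB.
Qed.

Lemma mean_op_iterC k phi : bounded_measurable phi ->
  iter k (conv_op f) (mean_op phi) = mean_op (iter k (conv_op f) phi).
Proof.
move=> bphi; elim: k => //= k ->; apply: conv_opC => //.
exact: bounded_measurable_iter.
Qed.

(** The dual form of the identity E(e_k^2) = C(n+k,k) F^k. In the inductive
    step the left-hand side splits along Pascal's rule into one term applied
    to [mean_op phi] and one applied to [conv_op f phi]. With A, B and Z the
    averages of (mean_op phi)^2, (conv_op f phi)^2 and phi^2, the induction
    hypotheses bound the squares of the terms by multiples of A and B;
    Bessel's inequality turns B into F (Z - A), so that [sqrD_le] recombines
    A and Z - A into Z. *)
Lemma sqr_iter_conv_op_le n k phi y : bounded_measurable phi ->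
  ('C(n + k, k)%:R * iter n mean_op (iter k (conv_op f) phi) y) ^+ 2 <=
  'C(n + k, k)%:R * F ^+ k * iter (n + k) mean_op (fun x => phi x ^+ 2) y.
Proof.
elim: n k phi => [|n IHn] k; elim: k => [|k IHk] phi bphi.
- by rewrite bin0 !mul1r.
- move/(_ _ (bounded_measurable_conv_op intf bphi)): IHk.
  rewrite !add0n !binn !mul1r -iterSr => /le_trans; apply.
  rewrite exprSr -mulrA ler_wpM2l ?exprn_ge0//.
  apply: le_trans (iter_mean_op_bessel k y bphi) _.
  rewrite ler_wpM2l// gerBl iter_mean_op_ge0//.
    exact/bounded_measurable_sqr/bounded_measurable_conv_op.
  by move=> x; exact: sqr_ge0.
- move/(_ 0%N _ (bounded_measurable_conv_op int1 bphi)): IHn.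
  rewrite !addn0 !bin0 expr0 !mul1r -iterSr => /le_trans; apply.
  exact: le_iter_sqr_mean_op.
- have := IHn k.+1 _ (bounded_measurable_conv_op int1 bphi).
  rewrite -/(mean_op phi) mean_op_iterC// -iterSr.
  have := IHk _ (bounded_measurable_conv_op intf bphi).
  rewrite -iterSr addSnnS.
  rewrite [in X in _ -> _ -> X]addSn binS natrD mulrDl.
  set c := ('C(_, k.+1)%:R : R); set c' := ('C(_, k)%:R : R).
  set u := iter n.+1 _ _ _.
  set A := iter _ _ (fun x => mean_op phi x ^+ 2) y.
  have := iter_mean_op_bessel (n + k.+1) y bphi; rewrite -/A.
  set B := iter (n + k.+1) _ (fun x => conv_op f phi x ^+ 2) y.
  set Z := iter (n + k.+1).+1 _ _ y.
  move=> leB q p.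
  have A_ge0 : 0 <= A.
    apply: iter_mean_op_ge0 => [|x]; last exact: sqr_ge0.
    exact/bounded_measurable_sqr/bounded_measurable_conv_op.
  have leAZ : A <= Z by exact: le_iter_sqr_mean_op.
  rewrite mulrDl -[X in _ <= _ * X](subrKC A).
  apply: sqrD_le => //; rewrite ?mulr_ge0 ?exprn_ge0 ?ler0n ?subr_ge0//.
  apply: le_trans q _; rewrite exprSr mulrA -[leRHS]mulrA ler_wpM2l//.
  by rewrite mulr_ge0 ?exprn_ge0 ?ler0n.
Qed.

End bessel.
End conv_op.

(** * Integrals against charges *)

Section charges.
Local Open Scope ereal_scope.
Context d (X : measurableType d) (R : realType).
Variable G : probability X R.

(** Two densities of the same measure agree almost everywhere, so that the
    change of variables formula for the Radon-Nikodym derivative transfers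
    to f. *)
Lemma integral_RN_density (mu : {finite_measure set X -> \bar R}) f psi :
  is_RN_density G mu f -> bounded_measurable psi ->
  \int[mu]_x (psi x)%:E = (\int[G]_x (f x * psi x))%R%:E.
Proof.
move=> [intf muE] bpsi.
have mu_G : mu `<< G.
  apply/null_content_dominatesP => A mA GA0.
  rewrite muE// null_set_integral//.
  by apply: measurable_funTS; exact: measurable_int intf.
have ipsi : mu.-integrable [set: X] (EFin \o psi).
  exact: bounded_measurable_integrable.
rewrite -(Radon_Nikodym_change_of_variables mu_G measurableT ipsi).
rewrite EFin_Rintegral; last exact: integrable_mul_bounded.
have RNf : ae_eq G [set: X]
    (Radon_Nikodym (charge_of_finite_measure mu) G) (EFin \o f).
  apply: integral_ae_eq => //.
  - exact: Radon_Nikodym_integrable.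
  - exact: measurable_int intf.
  - by move=> A _ mA; rewrite -Radon_Nikodym_integral//= -muE.
apply: ae_eq_integral => //.
- apply: emeasurable_funM; first exact: measurable_int ipsi.
  exact/measurable_int/Radon_Nikodym_integrable.
- exact: measurable_int (integrable_mul_bounded intf bpsi).
- by apply: filterS RNf => x /= RNfx _; rewrite RNfx// -EFinM mulrC.
Qed.

(** Stated through integrals of bounded functions, because this is how the
    density of the right factor enters a convolution. *)
Definition charge_density (V : {charge set X -> \bar R}) (f : X -> R) :=
  forall psi, bounded_measurable psi ->
    charge_integral V (EFin \o psi) = (\int[G]_x (f x * psi x))%R%:E.

Lemma RN_charge_density (V : {charge set X -> \bar R}) fp fm :
  is_RN_density G (pos_part V) fp -> is_RN_density G (neg_part V) fm ->
  charge_density V (fun x => fp x - fm x)%R.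
Proof.
move=> Vfp Vfm psi bpsi; rewrite /charge_integral (integral_RN_density Vfp bpsi)
  (integral_RN_density Vfm bpsi).
rewrite -EFinB -RintegralB//; last 2 first.
  by apply: integrable_mul_bounded => //; case: Vfp.
  by apply: integrable_mul_bounded => //; case: Vfm.
by congr EFin; apply: eq_Rintegral => x _; rewrite mulrBl.
Qed.

(** A charge that takes the values of a measure has a null negative part, so
    the choice of its Hahn decomposition does not affect the integral. *)
Lemma charge_integral_measure (V : {charge set X -> \bar R})
    (mu : {finite_measure set X -> \bar R}) (g : X -> \bar R) :
  (forall A, measurable A -> V A = mu A) ->
  charge_integral V g = \int[mu]_x g x.
Proof.
move=> Vmu.
have [_ [mN _] _ _] := hahn_setP V.
have neg0 A : measurable A -> neg_part V A = 0.
  move=> mA; apply/eqP; rewrite eq_le measure_ge0 andbT.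
  rewrite /neg_part/= jordan_negE cjordan_negE /crestr0 mem_set// /crestr.
  by rewrite leeNl oppe0 Vmu ?measure_ge0//; exact: measurableI.
have posE A : measurable A -> pos_part V A = mu A.
  by move=> mA; rewrite -Vmu// pos_part_sub_neg_part// neg0// sube0.
rewrite /charge_integral (eq_measure_integral mu); last first.
  by move=> A mA _; exact: posE.
rewrite [X in _ - X](eq_measure_integral mzero); last first.
  by move=> A mA _; exact: neg0.
by rewrite integral_measure_zero sube0.
Qed.

End charges.

(** * Convolution powers as iterated operators *)

Section convolutions.
Local Open Scope ereal_scope.
Context d (X : measurableAbelianGroupType d) (R : realType).
Variable G : probability X R.

(** All translates of A are treated at once: integrating the values on the
    translates by x is what the next convolution does. *)
Lemma convolution_power_translate (V : {charge set X -> \bar R}) f k A y :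
  G.-integrable [set: X] (EFin \o f) -> charge_density G V f -> measurable A ->
  convolution_power V k (translate A y) = (iter k (conv_op G f) \1_A y)%:E.
Proof.
move=> intf Vf mA; elim: k y => [|k IHk] y /=.
  rewrite [LHS]/= diracE translateE indicE.
  by congr ((_ : bool)%:R%:E); apply/idP/idP; rewrite !inE/= add0r.
transitivity (charge_integral V
    (EFin \o (fun x => iter k (conv_op G f) \1_A (x + y)%R))).
  congr charge_integral; apply/funext => x /=.
  rewrite -IHk; congr (convolution_power V k _).
  by rewrite !translateE; apply/seteqP; split => z /=; rewrite addrA.
rewrite Vf//; apply: bounded_measurable_shift.
apply: bounded_measurable_iter => //.
exact: bounded_measurable_indic.
Qed.

(** The right factor of a convolution is the integrating charge, so for the
    powers of G the integrals of functions are needed, not the values on sets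
    alone. The measure is built as the law of a sum: the image under addition
    of the product of G with the previous one. *)
Lemma convolution_power_probability n :
  exists mu : probability X R,
    (forall A, measurable A ->
      convolution_power (charge_of_finite_measure G) n A = mu A) /\
    (forall phi y, bounded_measurable phi ->
      \int[mu]_x (phi (x + y)%R)%:E = (iter n (mean_op G) phi y)%:E).
Proof.
elim: n => [|n [mu [muE mu_int]]] /=.
  exists \d_(0%R : X); split => // phi y bphi.
  rewrite integral_dirac//; last first.
    exact/measurable_EFinP/(bounded_measurable_shift y bphi).1.
  by rewrite diracE mem_set// mul1e add0r.
pose add : {mfun (X * X)%type >-> X} :=
  HB.pack (fun z : X * X => (z.1 + z.2)%R)
    (isMeasurableFun.Build _ _ _ _ _ (@measurable_add _ X)).
exists (distribution (G \x mu) add); split.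
  move=> A mA.
  rewrite [LHS]/convolution (charge_integral_measure (mu := G))//.
  apply: eq_integral => x _; rewrite /= muE; last exact: measurable_translate.
  congr (mu _); rewrite translateE; apply/seteqP; split => z;
    by rewrite /xsection/= ?inE/= addrC.
move=> phi y bphi.
have bphiy := bounded_measurable_shift y bphi.
have intphi : (G \x mu).-integrable [set: X * X]
    (EFin \o (fun z => phi (z.1 + z.2 + y)%R)).
  pose P : probability (X * X)%type R := G \x mu.
  apply: (bounded_measurable_integrable (T := (X * X)%type) P).
  exact: (bounded_measurable_comp (g := fun z : X * X => (z.1 + z.2)%R) bphiy
    (@measurable_add _ X)).
rewrite (integral_distribution (X := add))//; last first.
  exact/measurable_EFinP/bphiy.1.
rewrite -[LHS](integral12_prod_meas1 (m1 := G) (m2 := mu) intphi) /fubini_F /=.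
rewrite mean_opE EFin_Rintegral; last first.
  apply: bounded_measurable_integrable; apply: bounded_measurable_shift.
  by apply: bounded_measurable_iter => //; exact: integrable_cst_finite.
apply: eq_integral => x _; rewrite -mu_int//.
by apply: eq_integral => z _; rewrite addrCA addrA.
Qed.

End convolutions.

(** * The total variation norm of U^k G^n *)

Section tv.
Local Open Scope ereal_scope.
Context d (X : measurableType d) (R : realType).

Lemma tv_normE (V : {charge set X -> \bar R}) :
  tv_norm V = V (hahn_set_pos V) - V (hahn_set_neg V).
Proof.
have [[mP _] [mN _] _ _] := hahn_setP V.
rewrite /tv_norm charge_total_variationE /pos_part /neg_part/=.
rewrite jordan_posE jordan_negE cjordan_posE cjordan_negE /crestr0 !mem_set//.
by rewrite /crestr !setTI.
Qed.

End tv.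

Local Open Scope ereal_scope.

Lemma convolution_powersE (R : realType) (d : measure_display)
    (X : measurableAbelianGroupType d) (k n : nat) (G : probability X R)
    (V : {charge set X -> \bar R}) (f : X -> R) (A : set X) :
  G.-integrable [set: X] (EFin \o f) -> charge_density G V f -> measurable A ->
  convolution (convolution_power V k)
    (convolution_power (charge_of_finite_measure G) n) A =
  (iter n (mean_op G) (iter k (conv_op G f) \1_A) 0%R)%:E.
Proof.
move=> intf Vf mA; have [mu [muE mu_int]] := convolution_power_probability G n.
rewrite /convolution (charge_integral_measure (mu := mu))// -mu_int; last first.
  by apply: bounded_measurable_iter => //; exact: bounded_measurable_indic.
apply: eq_integral => x _.
by rewrite (convolution_power_translate _ _ intf Vf)// addr0.
Qed.

Theorem lemma4p2 (R : realType) (d : measure_display)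
    (X : measurableAbelianGroupType d) (k n : nat)
    (G : probability X R) (U : {charge set X -> \bar R}) (fp fm : X -> R) :
  (0 < k)%N ->
  charge_total_variation U `<< G ->
  U [set: X] = 0 ->
  is_RN_density G (pos_part U) fp ->
  is_RN_density G (neg_part U) fm ->
  tv_norm (convolution (convolution_power U k)
             (convolution_power (charge_of_finite_measure G) n)) <=
    (('C(n + k, k)%:R : R) `^ (- 2^-1))%R%:E *
    (\int[G]_x ((fp x - fm x) ^+ 2)%:E) `^ (k%:R / 2).
Proof.
move=> k_gt0 _ U0 Ufp Ufm.
set f := (fun x => fp x - fm x)%R; set V := convolution _ _.
have [[ifp _] [ifm _]] := (Ufp, Ufm).
have intf : G.-integrable [set: X] (EFin \o f).
  by rewrite /f; under [_ \o _]eq_fun do rewrite /= EFinB; exact: integrableB.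
have mf : measurable_fun [set: X] f.
  exact/measurable_EFinP/measurable_int/intf.
have Uf : charge_density G U f by exact: RN_charge_density.
have f0 : (\int[G]_x f x = 0)%R.
  rewrite RintegralB// /Rintegral -(Ufp.2 _ measurableT) -(Ufm.2 _ measurableT).
  by rewrite -fineB ?fin_num_measure// -pos_part_sub_neg_part// U0.
have binom_gt0 : (0 < 'C(n + k, k)%:R :> R)%R by rewrite ltr0n bin_gt0 leq_addl.
have [intf2|] := boolP (\int[G]_x (f x ^+ 2)%:E < +oo); last first.
  (* As 0 < k, an infinite second moment makes the bound infinite. *)
  rewrite -leNgt leye_eq => /eqP ->; rewrite poweRyr; last first.
    by rewrite mulf_neq0 ?invr_eq0 ?pnatr_eq0 -?lt0n.
  by rewrite gt0_muley ?leey// lte_fin powR_gt0.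
have {}intf2 : G.-integrable [set: X] (EFin \o (fun x => f x ^+ 2)%R).
  apply/integrableP; split; first exact/measurable_EFinP/measurable_funX.
  rewrite (eq_integral (fun x => (f x ^+ 2)%:E))// => x _ /=.
  by rewrite ger0_norm// sqr_ge0.
rewrite -EFin_Rintegral// poweR_EFin -EFinM.
have [[mP _] [mN _] _ _] := hahn_setP V.
set P := hahn_set_pos V in mP; set N := hahn_set_neg V in mN.
have bP := bounded_measurable_indic R mP.
have bN := bounded_measurable_indic R mN.
(* The sign of V, whose integral against V is the total variation norm. *)
pose phi x : R := (\1_P x - \1_N x)%R.
have bphi : bounded_measurable phi by exact: bounded_measurableB.
have tvE : tv_norm V = (iter n (mean_op G) (iter k (conv_op G f) phi) 0%R)%:E.
  have VE A : measurable A ->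
      V A = (iter n (mean_op G) (iter k (conv_op G f) \1_A) 0%R)%:E.
    exact: convolution_powersE.
  rewrite tv_normE -/P -/N [X in X - _]VE// [X in _ - X]VE// -EFinB.
  by rewrite iter_conv_opB// iter_conv_opB//;
    [exact: integrable_cst_finite|exact: bounded_measurable_iter..].
rewrite tvE lee_fin; apply: le_powR_sqr => //.
- by apply: Rintegral_ge0 => x _; exact: sqr_ge0.
- by rewrite -lee_fin -tvE measure_ge0.
- apply: le_trans (sqr_iter_conv_op_le intf intf2 f0 n k 0%R bphi) _.
  rewrite ler_piMr// ?mulr_ge0 ?ler0n ?exprn_ge0//.
    by apply: Rintegral_ge0 => x _; exact: sqr_ge0.
  rewrite -[leRHS](_ : iter (n + k) (mean_op G) (cst 1%R) 0%R = 1%R);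
    last first.
    by rewrite iter_mean_op_cst.
  apply: le_iter_mean_op => [||x]; first exact: bounded_measurable_sqr.
    exact: bounded_measurable_cst.
  rewrite /phi !indicE.
  by case: (x \in P); case: (x \in N); rewrite /=; lra.
Qed.
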